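(* Let $\mathsf{f}\in\mathbb{R}^n$, let $\mathsf{p}\in\mathbb{R}^n$ be a probability vector with $p_i>0$ for all $i$, and let $\beta\in[0,1)$. Suppose that there is an integer $k$ such that $\sum_{i=1}^kp_{(i)}<1-\beta<\sum_{i=1}^{k+1}p_{(i)}$, where the costs are ordered as $f_{(1)}\ge\cdots\ge f_{(n)}$. For a family of uncertainty sets $\mathcal{Q}(\varepsilon)$ of probability vectors and a growth function $g$, define $$\mathcal{S}_{\mathsf{p}}(\mathsf{f})=\lim_{\varepsilon\downarrow0}\frac{\max_{\mathsf{q}\in\mathcal{Q}(\varepsilon)}\mathrm{CVaR}_{\mathsf{q},\beta}(\mathsf{f})-\mathrm{CVaR}_{\mathsf{p},\beta}(\mathsf{f})}{g(\varepsilon)}.$$ Write $|\mathsf{f}-\mathrm{VaR}_{\mathsf{p},\beta}(\mathsf{f})\mathsf{1}|_+$ for the vector with components $\max\{f_i-\mathrm{VaR}_{\mathsf{p},\beta}(\mathsf{f}),0\}$. Then: (a) If $\mathcal{Q}(\varepsilon)=\mathcal{Q}_\phi(\varepsilon)$, where $\phi$ is strictly convex and twice continuously differentiable with $\phi(1)=\phi'(1)=0<\phi''(1)$, and $g(\varepsilon)=\sqrt{\varepsilon}$, then $$\mathcal{S}_{\mathsf{p}}(\mathsf{f})=\frac{1}{1-\beta}\sqrt{\frac{2}{\phi''(1)}\mathbb{V}_{\mathsf{p}}\big(|\mathsf{f}-\mathrm{VaR}_{\mathsf{p},\beta}(\mathsf{f})\mathsf{1}|_+\big)}.$$ (b) If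 $\mathcal{Q}(\varepsilon)=\mathcal{Q}_{\rm TV}(\varepsilon)$ and $g(\varepsilon)=\varepsilon$, then $$\mathcal{S}_{\mathsf{p}}(\mathsf{f})=\frac{1}{2(1-\beta)}\big(\max(\mathsf{f})-\mathrm{VaR}_{\mathsf{p},\beta}(\mathsf{f})\big).$$ (c) If $\mathcal{Q}(\varepsilon)=\mathcal{Q}_{\rm b}(\varepsilon)$ and $g(\varepsilon)=\varepsilon$, then $$\mathcal{S}_{\mathsf{p}}(\mathsf{f})=\mathrm{CVaR}_{\mathsf{p},\beta}(\mathsf{f})-\mathrm{VaR}_{\mathsf{p},\beta}(\mathsf{f}).$$ (d) If $\mathcal{Q}(\varepsilon)=\mathcal{Q}_{\rm c}(\varepsilon)$ (with fixed parameter $\alpha\in[0,1)$) and $g(\varepsilon)=\varepsilon$, then $$\mathcal{S}_{\mathsf{p}}(\mathsf{f})=\frac{1}{1-\beta}\Big(\mathrm{CVaR}_{\mathsf{p},\alpha}\big(|\mathsf{f}-\mathrm{VaR}_{\mathsf{p},\beta}(\mathsf{f})\mathsf{1}|_+\big)-\mathbb{E}_{\mathsf{p}}\big(|\mathsf{f}-\mathrm{VaR}_{\mathsf{p},\beta}(\mathsf{f})\mathsf{1}|_+\big)\Big).$$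
   Context: $p_{(i)}$ is the mass that $\mathsf{p}$ puts on the index corresponding to the $i$-th largest cost $f_{(i)}$ (ties broken by a fixed ordering); empty sums are $0$ and $k\in\{0,\dots,n-1\}$. For a probability vector $\mathsf{q}$ and a level $\alpha\in[0,1)$, $$\mathrm{CVaR}_{\mathsf{q},\alpha}(\mathsf{f})=\min_{\gamma\in\mathbb{R}}\Big\{\gamma+\frac{1}{1-\alpha}\sum_{i=1}^nq_i\max\{f_i-\gamma,0\}\Big\}.$$ $\mathrm{VaR}_{\mathsf{p},\beta}(\mathsf{f})$ is the $\beta$-quantile of $\mathsf{f}$ under $\mathsf{p}$; under the stated condition on $k$ it equals $f_{(k+1)}$. $\mathbb{E}_{\mathsf{p}}$ and $\mathbb{V}_{\mathsf{p}}$ denote mean and variance under $\mathsf{p}$; $\max(\mathsf{f})=\max_if_i$. Uncertainty sets (all vectors $\mathsf{q}\in\mathbb{R}^n$ with $\sum_iq_i=1$): - $\mathcal{Q}_\phi(\varepsilon)$: $\mathsf{q}\ge\mathsf{0}$ and $\sum_ip_i\phi(q_i/p_i)\le\varepsilon$ ($\phi$ real-valued with the stated smoothness on $(0,\infty)$, with $\phi(0)=\lim_{z\downarrow0}\phi(z)\in(-\infty,+\infty]$); - $\mathcal{Q}_{\rm TV}(\varepsilon)$: $\mathsf{q}\ge\mathsf{0}$ and $\sum_i|q_i-p_i|\le\varepsilon$; - $\mathcal{Q}_{\rm b}(\varepsilon)$: $\mathsf{0}\le\mathsf{q}\le(1+\varepsilon)\mathsf{p}$; - $\mathcal{Q}_{\rm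 c}(\varepsilon)$, $\varepsilon\in[0,1]$: $(1-\varepsilon)\mathsf{p}\le\mathsf{q}\le(1-\varepsilon)\mathsf{p}+\frac{\varepsilon}{1-\alpha}\mathsf{p}$. *)

(* Defs.v *)
From HB Require Import structures.
From mathcomp Require Import all_boot all_order all_algebra.
From mathcomp Require Import all_fingroup.
From mathcomp Require Import all_classical all_reals all_analysis.
From mathcomp Require Import ring lra.

Set Implicit Arguments.
Unset Strict Implicit.
Unset Printing Implicit Defensive.

Import Order.TTheory GRing.Theory Num.Theory.
Import numFieldNormedType.Exports.

Local Open Scope classical_set_scope.
Local Open Scope ring_scope.

Section FiniteRisk.
Context {R : realType} {n : nat}.
Implicit Types (p q f : 'rV[R]_n) (e alpha beta : R).

Definition prob_vec q : Prop :=
  (forall i, 0 <= q 0 i) /\ \sum_i q 0 i = 1.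

Definition sorts_decreasing (s : 'S_n) f : Prop :=
  forall i j : 'I_n, (i <= j)%N -> f 0 (s j) <= f 0 (s i).

Definition pmean p f : R := \sum_i p 0 i * f 0 i.

Definition pvariance p f : R := \sum_i p 0 i * (f 0 i - pmean p f) ^+ 2.

Definition max_cost f : R := sup (range (f 0)).

Definition CVaR_obj q alpha f (gamma : R) : R :=
  gamma + (1 - alpha)^-1 * \sum_i q 0 i * Num.max (f 0 i - gamma) 0.

(* The infimum is a minimum when q is a probability vector and alpha lies in
   [0, 1[ : see CVaR_is_min. *)
Definition CVaR q alpha f : R := inf (range (CVaR_obj q alpha f)).

(* The set is bounded below only when 0 < beta; at beta = 0 it is the whole
   line and the real-valued inf is a default value. *)
Definition VaR p beta f : R :=
  inf [set x : R | beta <= \sum_(i | f 0 i <= x) p 0 i].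

Definition excess p beta f : 'rV[R]_n :=
  \row_i Num.max (f 0 i - VaR p beta f) 0.

Definition is_max (A : set R) (m : R) : Prop := A m /\ ubound A m.

(* s is the limit, as e decreases to 0, of
   (max_(q in Q e) CVaR q beta f - CVaR p beta f) / g e. *)
Definition sensitivity p beta f (Q : R -> set 'rV[R]_n) (g : R -> R) (s : R)
    : Prop :=
  exists M : R -> R,
    (\forall e \near 0^'+, is_max [set CVaR q beta f | q in Q e] (M e)) /\
    (M e - CVaR p beta f) / g e @[e --> 0^'+] --> s.

(* phi on ]0, +oo[, extended to 0 by its right limit there, possibly +oo *)
Definition phi_ext (phi : R -> R) (z : R) : \bar R :=
  if 0 < z then (phi z)%:E else lim ((phi x)%:E @[x --> 0^'+]).

Definition strictly_convex_pos (phi : R -> R) : Prop :=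
  forall x y t : R, 0 < x -> 0 < y -> x != y -> 0 < t < 1 ->
    phi (t * x + (1 - t) * y) < t * phi x + (1 - t) * phi y.

Definition C2_pos (phi : R -> R) : Prop :=
  forall x : R, 0 < x ->
    [/\ derivable phi x 1, derivable (derive1 phi) x 1 &
        {for x, continuous (derive1n 2 phi)}].

Definition Q_phi p (phi : R -> R) e : set 'rV[R]_n :=
  [set q : 'rV[R]_n | prob_vec q /\
    (\sum_i (p 0 i)%R%:E * phi_ext phi (q 0 i / p 0 i)%R <= e%:E)%E].

Definition Q_TV p e : set 'rV[R]_n :=
  [set q : 'rV[R]_n | prob_vec q /\ \sum_i `|q 0 i - p 0 i| <= e].

Definition Q_b p e : set 'rV[R]_n :=
  [set q : 'rV[R]_n | \sum_i q 0 i = 1 /\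
    forall i, 0 <= q 0 i <= (1 + e) * p 0 i].

Definition Q_c p alpha e : set 'rV[R]_n :=
  [set q : 'rV[R]_n | \sum_i q 0 i = 1 /\
    forall i, (1 - e) * p 0 i <= q 0 i
              <= (1 - e) * p 0 i + e / (1 - alpha) * p 0 i].

Lemma CVaR_is_min q alpha f : prob_vec q -> 0 <= alpha < 1 ->
  exists2 gamma, CVaR q alpha f = CVaR_obj q alpha f gamma &
    forall gamma', CVaR_obj q alpha f gamma <= CVaR_obj q alpha f gamma'.
Proof.
move=> [q0 q1] /andP[a0 a1].
have b1 : 1 <= (1 - alpha)^-1 by rewrite invf_ge1; lra.
suff [g gmin] : exists g, forall g', CVaR_obj q alpha f g <= CVaR_obj q alpha f g'.
  exists g => //; apply/eqP; rewrite eq_le; apply/andP; split.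
    apply: ge_inf; last by exists g.
    by exists (CVaR_obj q alpha f g) => _ [x _ <-].
  by apply: lb_le_inf; [exists (CVaR_obj q alpha f g), g | move=> _ [x _ <-]].
pose B := \sum_i `|f 0 i|.
have fB i : - B <= f 0 i <= B.
  by rewrite -ler_norml /B (bigD1 i) //= lerDl sumr_ge0.
have B0 : 0 <= B by apply: sumr_ge0.
have cobj : continuous (CVaR_obj q alpha f).
  move=> x; apply: cvgD => //; apply: cvgM; first exact: cvg_cst.
  apply: cvg_big => [|i _]; first exact: add_continuous.
  apply: cvgM; first exact: cvg_cst.
  apply: (@continuous_max R R (fun g => f 0 i - g) (fun=> 0)).
    by apply: cvgB => //; exact: cvg_cst.
  exact: cvg_cst.
have [c _ cmin] : exists2 c, c \in `[(- B), B] &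
    forall t, t \in `[(- B), B] -> CVaR_obj q alpha f c <= CVaR_obj q alpha f t.
  by apply: EVT_min; [lra | exact: continuous_subspaceT].
have low x : x <= - B ->
    CVaR_obj q alpha f x = x + (1 - alpha)^-1 * (pmean q f - x).
  move=> xB; congr (_ + _ * _); rewrite -[X in _ - X]mul1r -q1 mulr_suml -sumrB.
  apply: eq_bigr => i _; rewrite max_l ?mulrBr //.
  by have /andP[] := fB i; lra.
have high x : B <= x -> CVaR_obj q alpha f x = x.
  move=> Bx; rewrite /CVaR_obj big1 ?mulr0 ?addr0 // => i _.
  by rewrite max_r ?mulr0 //; have /andP[] := fB i; lra.
exists c => x; have [xB|Bx] := leP x (- B).
  apply: le_trans (cmin (- B) _) _; first by rewrite in_itv /=; lra.
  by rewrite !low //; nra.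
have [xB|Bx'] := leP x B; first by apply: cmin; rewrite in_itv /=; lra.
apply: le_trans (cmin B _) _; first by rewrite in_itv /=; lra.
by rewrite !high //; lra.
Qed.

End FiniteRisk.

(* Main.v *)
(* The strict condition on k says that v := VaR is a beta-quantile of f with
   strict slack on both sides, so v stays a minimizer in the definition of CVaR
   for every q close to p; hence CVaR_q = v + E_q[h] / (1 - beta) there, with
   h := max(f - v, 0), and one is left with the first-order growth of the
   worst-case mean max_(q in Q e) E_q[h].
   - Q_phi: near 1 the divergence is (phi''(1)/2) (z - 1)^2 up to a factor close
     to 1; Cauchy-Schwarz bounds E_q[h] - E_p[h], and the tilt
     q = p (1 + t (h - E_p h)) attains the bound.
   - Q_TV: mass e/2 moves from a point with h = 0 to a maximizer of h.
   - Q_b: the weights on {h > 0} are scaled by 1 + e, the excess mass being taken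
     from {h = 0}, which has positive probability.
   - Q_c: q = (1 - e) p + e r, where r ranges over the dual set of CVaR_alpha. *)

Require Import Defs.
From HB Require Import structures.
From mathcomp Require Import all_boot all_order all_algebra.
From mathcomp Require Import all_fingroup.
From mathcomp Require Import all_classical all_reals all_analysis.
From mathcomp Require Import ring lra.

Set Implicit Arguments.
Unset Strict Implicit.
Unset Printing Implicit Defensive.

Import Order.TTheory GRing.Theory Num.Theory.
Import numFieldNormedType.Exports.

Local Open Scope classical_set_scope.
Local Open Scope ring_scope.

(** * CVaR and its dual representation *)

Section FiniteRiskLemmas.
Context {R : realType} {n : nat}.
Implicit Types (p q r f : 'rV[R]_n) (beta gamma e : R).

(** The objective is convex and piecewise linear; its right and left slopes at [gamma] are 1 minus
    the open, resp. closed, upper-tail mass divided by [1 - beta]. The hypothesis puts 0 between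
    these slopes. *)
Lemma CVaR_obj_min q beta f gamma : prob_vec q -> beta < 1 ->
  \sum_(i | gamma < f 0 i) q 0 i <= 1 - beta
    <= \sum_(i | gamma <= f 0 i) q 0 i ->
  CVaR q beta f = CVaR_obj q beta f gamma.
Proof.
move=> [q0 q1] b1 /andP[lo hi].
have bV : 0 < (1 - beta)^-1 by rewrite invr_gt0 subr_gt0.
have bK : (1 - beta)^-1 * (1 - beta) = 1 by rewrite mulVf // lt0r_neq0 // subr_gt0.
suff min g : CVaR_obj q beta f gamma <= CVaR_obj q beta f g.
  apply/eqP; rewrite eq_le; apply/andP; split.
    apply: ge_inf; last by exists gamma.
    by exists (CVaR_obj q beta f gamma) => _ [x _ <-].
  by apply: lb_le_inf; [exists (CVaR_obj q beta f gamma), gamma | move=> _ [x _ <-]].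
(* Each hinge dominates its tangent of slope -1 on [P] and 0 elsewhere. At the kink [f 0 i = gamma]
   the usable slope depends on the side of [g]: closed tail to the left, open tail to the right. *)
have subgradient (P : pred 'I_n) :
    (forall i, (if P i then gamma - g else 0) <=
               Num.max (f 0 i - g) 0 - Num.max (f 0 i - gamma) 0) ->
    (gamma - g) * (1 - beta) <= (gamma - g) * \sum_(i | P i) q 0 i ->
  CVaR_obj q beta f gamma <= CVaR_obj q beta f g.
  move=> HP; rewrite -(ler_pM2l bV) mulrCA bK mulr1 => h1.
  suff : gamma - g <= (1 - beta)^-1 * (\sum_i q 0 i * Num.max (f 0 i - g) 0 -
      \sum_i q 0 i * Num.max (f 0 i - gamma) 0) by rewrite /CVaR_obj mulrBr; lra.
  rewrite -sumrB; apply: (le_trans h1); rewrite ler_pM2l // mulr_sumr big_mkcond /=.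
  apply: ler_sum => i _; have := HP i; case: ifP => _ H.
    by rewrite mulrC -mulrBr ler_wpM2l.
  by rewrite -mulrBr mulr_ge0.
have [gg|gg] := leP g gamma.
  apply: (subgradient (fun i => gamma <= f 0 i)); last first.
    by rewrite ler_wpM2l // subr_ge0.
  move=> i; rewrite !maxEle; do !case: ifPn; rewrite -?ltNge; lra.
apply: (subgradient (fun i => gamma < f 0 i)); last first.
  by rewrite ler_wnM2l // subr_le0 ltW.
move=> i; rewrite !maxEle; do !case: ifPn; rewrite -?ltNge -?leNgt; lra.
Qed.

Lemma CVaR_obj_excess q beta f gamma :
  CVaR_obj q beta f gamma =
  gamma + (1 - beta)^-1 * pmean q (\row_i Num.max (f 0 i - gamma) 0).
Proof. by rewrite /CVaR_obj /pmean; under [in RHS]eq_bigr do rewrite mxE. Qed.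

Lemma pmeanB q p f : \sum_i (q 0 i - p 0 i) * f 0 i = pmean q f - pmean p f.
Proof. by rewrite -sumrB; apply: eq_bigr => i _; rewrite mulrBl. Qed.

(** Weak duality: bound [f 0 i] by [g] plus its hinge at the minimizer [g], average under [r], and
    replace [r] by its cap on the nonnegative hinge. *)
Lemma pmean_le_CVaR p r alpha f : prob_vec p -> 0 <= alpha < 1 ->
  \sum_i r 0 i = 1 -> (forall i, 0 <= r 0 i <= (1 - alpha)^-1 * p 0 i) ->
  pmean r f <= CVaR p alpha f.
Proof.
move=> pp ha r1 rb; have [g -> _] := CVaR_is_min f pp ha.
rewrite /CVaR_obj mulr_sumr -[X in _ <= X + _]mulr1 -[X in _ * X + _]r1 mulr_sumr -big_split /=.
apply: ler_sum => i _; have /andP[r0 rp] := rb i.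
have : f 0 i - g <= Num.max (f 0 i - g) 0 by rewrite le_max lexx.
have : 0 <= Num.max (f 0 i - g) 0 by rewrite le_max lexx orbT.
move: (Num.max _ _) => m m0 fm; rewrite mulrA.
have := ler_wpM2r m0 rp; have := ler_wpM2l r0 fm; lra.
Qed.

(** Take the largest cost whose closed upper tail still has mass at least [1 - alpha]; the smallest
    cost is a candidate, since its tail is everything. *)
Lemma exists_quantile p alpha f : prob_vec p -> 0 <= alpha < 1 ->
  exists i0, \sum_(i | f 0 i0 < f 0 i) p 0 i <= 1 - alpha
    <= \sum_(i | f 0 i0 <= f 0 i) p 0 i.
Proof.
move=> [p0 p1] /andP[a0 a1].
have [j0 _] : exists j0 : 'I_n, true.
  case: (pickP (fun _ : 'I_n => true)) => [j _|no]; first by exists j.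
  by move: p1; rewrite big_pred0 // => /eqP; rewrite eq_sym oner_eq0.
pose P i0 := 1 - alpha <= \sum_(i | f 0 i0 <= f 0 i) p 0 i.
have Pmin : P [arg min_(i < j0) f 0 i]%O.
  case: arg_minP => // i _ imin; rewrite /P (eq_bigl predT); last by move=> j; exact: imin.
  by rewrite p1; lra.
pose i0 := [arg max_(i > [arg min_(i < j0) f 0 i]%O | P i) f 0 i]%O.
have [Pi0 i0max] : P i0 /\ forall j, P j -> f 0 j <= f 0 i0.
  by rewrite /i0; case: arg_maxP.
exists i0; apply/andP; split; last exact: Pi0.
have [j1 hj1|none] := pickP (fun j => f 0 i0 < f 0 j); last first.
  by rewrite big_pred0 //; lra.
have [j hj jmin] : exists2 j, f 0 i0 < f 0 j &
    forall i, f 0 i0 < f 0 i -> f 0 j <= f 0 i.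
  case: (@arg_minP _ _ _ j1 (fun j => f 0 i0 < f 0 j) (f 0) hj1) => j hj jm.
  by exists j.
(* [f 0 j] is the next cost value above [f 0 i0], so the open tail of one is the closed tail of the
   other; maximality of [i0] bounds the latter. *)
have -> : \sum_(i | f 0 i0 < f 0 i) p 0 i = \sum_(i | f 0 j <= f 0 i) p 0 i.
  apply: eq_bigl => i; apply/idP/idP; first exact: jmin.
  exact: lt_le_trans.
rewrite leNgt; apply/negP => h; have := i0max j (ltW h).
by rewrite leNgt hj.
Qed.

(** Strong duality: the optimal [r] has the full density [(1 - alpha)^-1] above the quantile,
    density 0 below it, and a fraction [t] of the cap on the atom at the quantile, chosen to make
    the total mass 1. *)
Lemma CVaR_dual_attained p alpha f : prob_vec p -> 0 <= alpha < 1 ->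
  exists r, [/\ \sum_i r 0 i = 1,
    forall i, 0 <= r 0 i <= (1 - alpha)^-1 * p 0 i & pmean r f = CVaR p alpha f].
Proof.
move=> pp ha; have [i0 /andP[lo hi]] := exists_quantile f pp ha.
have [[p0 p1] /andP[a0 a1]] := (pp, ha).
rewrite (CVaR_obj_min pp a1 (gamma := f 0 i0)) ?lo //.
set g := f 0 i0 in lo hi *; set c := (1 - alpha)^-1.
have c0 : 0 < c by rewrite invr_gt0 subr_gt0.
have cK : c * (1 - alpha) = 1 by rewrite mulVf // lt0r_neq0 // subr_gt0.
set A := \sum_(i | g < f 0 i) p 0 i in lo.
pose B := \sum_(i | f 0 i == g) p 0 i.
have AB : \sum_(i | g <= f 0 i) p 0 i = A + B.
  rewrite (bigID (fun i => g < f 0 i)) /=; congr (_ + _); apply: eq_bigl => i.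
    by case: ltgtP.
  by case: ltgtP.
have B0 : 0 <= B by apply: sumr_ge0.
(* If the atom is null, the two tail bounds already force [A = 1 - alpha], and [t = 0] serves. *)
have [t t01 tB] : exists2 t, 0 <= t <= 1 & A + t * B = 1 - alpha.
  rewrite AB in hi; have [B00|Bn0] := eqVneq B 0.
    by exists 0; [rewrite lexx ler01 | move: hi; rewrite B00; lra].
  have Bp : 0 < B by rewrite lt_def Bn0.
  exists ((1 - alpha - A) / B); last by rewrite divfK //; lra.
  by rewrite divr_ge0 ?ler_pdivrMr //=; lra.
pose w i : R := if g < f 0 i then 1 else if f 0 i == g then t else 0.
have wb i : 0 <= w i <= 1 by rewrite /w; do 2?case: ifP => _ //; rewrite ?lexx ?ler01.
pose r := \row_i (c * (w i * p 0 i)).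
have r1 : \sum_i r 0 i = 1.
  under eq_bigr do rewrite mxE.
  rewrite -mulr_sumr -cK -tB; congr (_ * _).
  rewrite (bigID (fun i => g < f 0 i)) /=; congr (_ + _).
    by apply: eq_bigr => i gi; rewrite /w gi mul1r.
  rewrite (bigID (fun i => f 0 i == g)) /= [X in _ + X]big1 ?addr0; last first.
    by move=> i /andP[/negbTE gi /negbTE ng]; rewrite /w gi ng mul0r.
  rewrite mulr_sumr; apply: eq_big => [i|i /andP[/negbTE gi /eqP ng]].
    by case: ltgtP.
  by rewrite /w gi ng eqxx.
exists r; split => // [i|].
  rewrite mxE; have /andP[w0 w1] := wb i.
  rewrite mulr_ge0 ?mulr_ge0 ?(ltW c0) //=.
  by rewrite ler_pM2l // ler_piMl.
have -> : pmean r f = g + \sum_i r 0 i * (f 0 i - g).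
  under eq_bigr do rewrite mulrBr.
  by rewrite sumrB -mulr_suml r1 mul1r addrC subrK.
rewrite /CVaR_obj -/c; congr (_ + _); rewrite mulr_sumr; apply: eq_bigr => i _.
rewrite mxE -!mulrA; congr (_ * _); rewrite /w.
(* Complementary slackness: where the density is neither full nor zero, [f 0 i - g] vanishes. *)
case: (ltgtP g (f 0 i)) => [gi|gi|<-].
- by rewrite mul1r max_l // subr_ge0 ltW.
- by rewrite mul0r max_r ?mulr0 // subr_le0 ltW.
- by rewrite subrr max_l // !mulr0.
Qed.

End FiniteRiskLemmas.

(** * Local linearity of CVaR *)

Section LocalLinearity.
Context {R : realType} {n : nat}.
Implicit Types (p q f : 'rV[R]_n) (beta v : R) (Q : R -> set 'rV[R]_n).

(** The condition on [k] freed from the sorting permutation; being made of strict inequalities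
    between tail masses, it is open in [p]. *)
Definition strict_quantile p beta f v :=
  \sum_(i | v < f 0 i) p 0 i < 1 - beta < \sum_(i | v <= f 0 i) p 0 i.

(** Positions count from 0, so [s k] carries the (k+1)-th largest cost. A cost strictly above it
    sits at a position before [k], and positions up to [k] have costs at least as large, whatever
    the ties. *)
Lemma sorted_strict_quantile p beta f (s : 'S_n) (k : 'I_n) :
  (forall i, 0 <= p 0 i) -> sorts_decreasing s f ->
  \sum_(i < n | (i < k)%N) p 0 (s i) < 1 - beta
    < \sum_(i < n | (i < k.+1)%N) p 0 (s i) ->
  strict_quantile p beta f (f 0 (s k)).
Proof.
move=> p0 hs /andP[lo hi]; rewrite /strict_quantile.
rewrite (reindex_inj (@perm_inj _ s)) [X in _ && (_ < X)](reindex_inj (@perm_inj _ s)) /=.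
apply/andP; split.
  apply: le_lt_trans lo; rewrite big_mkcond [leRHS]big_mkcond /=.
  apply: ler_sum => i _; case: ifP => [fi|_]; last by case: ifP.
  rewrite ifT // ltnNge; apply/negP => /hs; by rewrite leNgt fi.
apply: (lt_le_trans hi); rewrite big_mkcond [leRHS]big_mkcond /=.
by apply: ler_sum => i _; case: ifP => [/hs ->//|_]; case: ifP.
Qed.

(** A point [x < v] has an open tail containing the closed tail of [v], too heavy for [x] to enter
    the set defining [VaR]. The second strict inequality forces [0 < beta], so the [inf] is not a
    default value. *)
Lemma VaR_strict_quantile p beta f v : prob_vec p ->
  strict_quantile p beta f v -> VaR p beta f = v.
Proof.
move=> [p0 p1] /andP[lo hi].
have cdf x : \sum_(i | f 0 i <= x) p 0 i = 1 - \sum_(i | x < f 0 i) p 0 i.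
  rewrite -p1 [in RHS](bigID (fun i => x < f 0 i)) /= addrAC subrr add0r.
  by apply: eq_bigl => i; rewrite leNgt.
rewrite /VaR; apply/eqP; rewrite eq_le; apply/andP; split.
  apply: ge_inf; last by rewrite /= cdf; lra.
  exists v => x /=; rewrite cdf => bx; rewrite leNgt; apply/negP => xv.
  suff : \sum_(i | v <= f 0 i) p 0 i <= \sum_(i | x < f 0 i) p 0 i by lra.
  rewrite big_mkcond [leRHS]big_mkcond /=.
  by apply: ler_sum => i _; case: ifP => [/(lt_le_trans xv) ->//|_]; case: ifP.
apply: lb_le_inf; first by exists v; rewrite /= cdf; lra.
move=> x /=; rewrite cdf => bx; rewrite leNgt; apply/negP => xv.
suff : \sum_(i | v <= f 0 i) p 0 i <= \sum_(i | x < f 0 i) p 0 i by lra.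
rewrite big_mkcond [leRHS]big_mkcond /=.
by apply: ler_sum => i _; case: ifP => [/(lt_le_trans xv) ->//|_]; case: ifP.
Qed.

(** If no cost equalled [v], its open and closed tails would coincide. Such an index has zero excess
    and can give up mass for free. *)
Lemma strict_quantile_exists p beta f v : strict_quantile p beta f v ->
  exists i, f 0 i = v.
Proof.
move=> /andP[lo hi]; have [i /eqP|none] := pickP (fun i => f 0 i == v).
  by exists i.
have : 1 - beta < 1 - beta; last by rewrite ltxx.
apply: lt_trans hi _; apply: le_lt_trans lo; rewrite le_eqVlt; apply/orP; left.
apply/eqP/eq_bigl => i; rewrite le_eqVlt; have := none i; rewrite eq_sym => ->.
by [].
Qed.

Lemma CVaR_strict_quantile q beta f v : prob_vec q -> beta < 1 ->
  strict_quantile q beta f v ->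
  CVaR q beta f = v + (1 - beta)^-1 * pmean q (\row_i Num.max (f 0 i - v) 0).
Proof.
move=> qq b1 /andP[lo hi]; rewrite (CVaR_obj_min (gamma := v)) // ?ltW //.
exact: CVaR_obj_excess.
Qed.

Lemma strict_quantile_near p beta f v : strict_quantile p beta f v ->
  exists2 d : R, 0 < d &
    forall q, \sum_i `|q 0 i - p 0 i| <= d -> strict_quantile q beta f v.
Proof.
rewrite /strict_quantile.
set A := \sum_(i | v < _) _; set B := \sum_(i | _) _ => /andP[lo hi].
(* Every tail mass moves by at most the l1 distance; half the smaller slack keeps both inequalities
   strict. *)
pose d := Num.min ((1 - beta) - A) (B - (1 - beta)) / 2.
have d0 : 0 < Num.min ((1 - beta) - A) (B - (1 - beta)) by rewrite lt_min; lra.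
exists d; first by rewrite divr_gt0.
move=> q qd.
have close (P : pred 'I_n) : `|\sum_(i | P i) q 0 i - \sum_(i | P i) p 0 i| <= d.
  rewrite -sumrB; apply: le_trans qd; apply: le_trans (ler_norm_sum _ _ _) _.
  rewrite big_mkcond /=; apply: ler_sum => i _; by case: ifP.
have d1 : 2 * d <= (1 - beta) - A by rewrite mulrC divfK // ge_min lexx.
have d2 : 2 * d <= B - (1 - beta) by rewrite mulrC divfK // ge_min lexx orbT.
have := close (fun i => v < f 0 i); have := close (fun i => v <= f 0 i).
rewrite -/A -/B !ler_norml.
have : 0 < d by rewrite divr_gt0.
move: d1 d2; lra.
Qed.

(* CVaR is affine in the probability vector near p, so only the worst-case
   mean of the excess matters for the sensitivity. *)
Lemma sensitivity_pmean p beta f Q (g m : R -> R) (l : R) :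
  prob_vec p -> beta < 1 -> strict_quantile p beta f (VaR p beta f) ->
  (forall d : R, 0 < d -> \forall e \near 0^'+, forall q, Q e q ->
     prob_vec q /\ \sum_i `|q 0 i - p 0 i| <= d) ->
  (\forall e \near 0^'+,
     is_max [set pmean q (excess p beta f) | q in Q e] (m e)) ->
  (m e - pmean p (excess p beta f)) / g e @[e --> 0^'+] --> l ->
  sensitivity p beta f Q g ((1 - beta)^-1 * l).
Proof.
move=> pp b1 hq hQ hm hl; set v := VaR p beta f in hq.
have c0 : 0 < (1 - beta)^-1 by rewrite invr_gt0 subr_gt0.
have [d d0 hd] := strict_quantile_near hq.
(* An increasing affine image of the worst-case mean, hence attained at the same vectors. *)
exists (fun e => v + (1 - beta)^-1 * m e); split.
  near=> e.
  have CE q : Q e q ->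
      CVaR q beta f = v + (1 - beta)^-1 * pmean q (excess p beta f).
    move=> Qq; have [qq dq] : prob_vec q /\ \sum_i `|q 0 i - p 0 i| <= d.
      by move: q Qq; near: e; exact: hQ.
    by apply: CVaR_strict_quantile => //; exact: hd.
  have [[q Qq qm] ub] : is_max [set pmean q (excess p beta f) | q in Q e] (m e).
    by near: e.
  split; first by exists q => //; rewrite CE // qm.
  move=> _ [r Qr <-]; rewrite CE // lerD2l ler_pM2l //.
  by apply: ub; exists r.
rewrite (CVaR_strict_quantile pp b1 hq) -/(excess p beta f).
have -> : (fun e => (v + (1 - beta)^-1 * m e -
    (v + (1 - beta)^-1 * pmean p (excess p beta f))) / g e) =
    (fun e => (1 - beta)^-1 * ((m e - pmean p (excess p beta f)) / g e)).
  by apply/funext => e; rewrite mulrA; congr (_ / _); rewrite mulrBr; lra.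
by apply: cvgM => //; exact: cvg_cst.
Unshelve. all: by end_near. Qed.

(** When the worst-case mean is exactly affine in [e] near 0, the quotient is eventually
    constant. *)
Lemma sensitivity_pmean_linear p beta f Q (l : R) :
  prob_vec p -> beta < 1 -> strict_quantile p beta f (VaR p beta f) ->
  (forall d : R, 0 < d -> \forall e \near 0^'+, forall q, Q e q ->
     prob_vec q /\ \sum_i `|q 0 i - p 0 i| <= d) ->
  (\forall e \near 0^'+, is_max [set pmean q (excess p beta f) | q in Q e]
     (pmean p (excess p beta f) + e * l)) ->
  sensitivity p beta f Q (fun e => e) ((1 - beta)^-1 * l).
Proof.
move=> pp b1 hq hQ hm; apply: sensitivity_pmean hm _ => //.
apply: cvg_near_cst; near=> e.
by rewrite addrC addKr mulrC mulKf.
Unshelve. all: by end_near. Qed.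

(** A one-sided cap suffices: [x <= K * p] gives [|x| <= 2 * K * p - x], and the terms [x = q - p]
    sum to 0. *)
Lemma sum_norm_relative_bound p q (K : R) : prob_vec p -> \sum_i q 0 i = 1 ->
  0 <= K -> (forall i, q 0 i <= (1 + K) * p 0 i) ->
  \sum_i `|q 0 i - p 0 i| <= 2 * K.
Proof.
move=> [p0 p1] q1 K0 qK.
have -> : 2 * K = \sum_i (2 * K * p 0 i - (q 0 i - p 0 i)).
  by rewrite sumrB -mulr_sumr sumrB p1 q1; lra.
apply: ler_sum => i _; rewrite ler_norml.
have := qK i; have := mulr_ge0 K0 (p0 i); lra.
Qed.

Lemma excess_ge0 p beta f i : 0 <= excess p beta f 0 i.
Proof. by rewrite mxE le_max lexx orbT. Qed.

Lemma prob_vec_gt0_lb p : (forall i, 0 < p 0 i) ->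
  exists2 c : R, 0 < c & forall i, c <= p 0 i.
Proof.
move=> p0; case: (pickP (fun _ : 'I_n => true)) => [j _|none].
  have [i _ imin] := @arg_minP _ _ _ j predT (fun i => p 0 i) isT.
  by exists (p 0 i) => // k; exact: imin.
by exists 1 => // i; have := none i.
Qed.

End LocalLinearity.

(** * Sets with explicit worst cases *)

Section ExplicitWorstCases.
Context {R : realType} {n : nat}.
Implicit Types (p q r h : 'rV[R]_n) (e : R).

(** The cap bounds each term separately because [h] is nonnegative. It is reached wherever [h] is
    positive, and the zero set of [h] absorbs the normalisation. *)
Lemma Q_b_max p h e i0 : prob_vec p -> (forall i, 0 < p 0 i) ->
  (forall i, 0 <= h 0 i) -> h 0 i0 = 0 -> 0 < e <= p 0 i0 ->
  is_max [set pmean q h | q in Q_b p e] (pmean p h + e * pmean p h).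
Proof.
move=> [p0 p1] pp h0 hi0 /andP[e0 ei].
have -> : pmean p h + e * pmean p h = \sum_i (1 + e) * p 0 i * h 0 i.
  rewrite -{1}[pmean p h]mul1r -mulrDl mulr_sumr.
  by apply: eq_bigr => i _; rewrite mulrA.
split; last first.
  move=> _ [q [q1 qb] <-]; apply: ler_sum => i _.
  by apply: ler_wpM2r => //; have /andP[] := qb i.
pose a := \sum_(i | 0 < h 0 i) p 0 i; pose b := \sum_(i | ~~ (0 < h 0 i)) p 0 i.
have ab : a + b = 1 by rewrite -p1 [in RHS](bigID (fun i => 0 < h 0 i)).
have a0 : 0 <= a by apply: sumr_ge0.
have b0 : p 0 i0 <= b.
  by rewrite /b (bigD1 i0) ?hi0 ?ltxx //= lerDl; apply: sumr_ge0.
have bgt0 : 0 < b by apply: lt_le_trans b0; apply: pp.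
(* Removing mass [e * a] from a set of mass [b] leaves nonnegative weights, as [a <= 1] and
   [e <= p 0 i0 <= b]. *)
have ec : 0 <= e * (a / b) <= 1.
  rewrite mulr_ge0 ?(ltW e0) ?divr_ge0 ?(ltW bgt0) //=.
  rewrite mulrA ler_pdivrMr // mul1r; apply: le_trans b0; apply: le_trans ei.
  by rewrite ler_piMr ?(ltW e0) //; lra.
exists (\row_i ((if 0 < h 0 i then 1 + e else 1 - e * (a / b)) * p 0 i)); last first.
  apply: eq_bigr => i _; rewrite mxE; case: ifPn => // hi.
  have -> : h 0 i = 0 by apply/eqP; rewrite eq_le h0 andbT leNgt.
  by rewrite !mulr0.
split; last first.
  move=> i; rewrite mxE; apply/andP; split.
    by apply: mulr_ge0 => //; case: ifP => _; lra.
  by apply: ler_wpM2r => //; case: ifP => _; lra.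
under eq_bigr do rewrite mxE.
rewrite (bigID (fun i => 0 < h 0 i)) /=.
rewrite (eq_bigr (fun i => (1 + e) * p 0 i)) => [|i ->] //.
rewrite -mulr_sumr -/a.
rewrite [X in _ + X](eq_bigr (fun i => (1 - e * (a / b)) * p 0 i)) => [|i /negbTE->] //.
rewrite -mulr_sumr -/b mulrBl -!mulrA mulVf ?gt_eqF //; lra.
Qed.

(** Since [q - p] sums to 0, [h] may be recentred at half its maximum, which halves its sup norm;
    the l1 to sup-norm pairing then gives the sharp bound. *)
Lemma Q_TV_max p h e i0 i1 : prob_vec p ->
  (forall i, 0 <= h 0 i <= h 0 i1) -> h 0 i0 = 0 -> 0 < e <= p 0 i0 ->
  is_max [set pmean q h | q in Q_TV p e] (pmean p h + e * (h 0 i1 / 2)).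
Proof.
move=> [p0 p1] hb hi0 /andP[e0 ei]; split; last first.
  move=> _ [q [[q0 q1] qe] <-]; rewrite -lerBlDl -pmeanB.
  have -> : \sum_i (q 0 i - p 0 i) * h 0 i =
      \sum_i (q 0 i - p 0 i) * (h 0 i - h 0 i1 / 2).
    under [RHS]eq_bigr do rewrite mulrBr.
    by rewrite sumrB -mulr_suml sumrB q1 p1 subrr mul0r subr0.
  apply: (@le_trans _ _ (\sum_i `|q 0 i - p 0 i| * (h 0 i1 / 2))); last first.
    rewrite -mulr_suml ler_wpM2r //; have := hb i1; lra.
  apply: ler_sum => i _; apply: le_trans (ler_norm _) _.
  rewrite normrM ler_wpM2l // ler_norml; have := hb i; lra.
(* If [i0 = i1], then [h] is zero everywhere and [q = p] is consistent with a gain of 0. *)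
pose q : 'rV[R]_n := \row_i (p 0 i + e / 2 * ((i == i1)%:R - (i == i0)%:R)).
have qp i : q 0 i - p 0 i = e / 2 * ((i == i1)%:R - (i == i0)%:R).
  by rewrite mxE addrC addKr.
have delta (F : 'I_n -> R) j : \sum_i (i == j)%:R * F i = F j.
  rewrite (bigD1 j) //= eqxx mul1r big1 ?addr0 // => i /negbTE ->.
  by rewrite mul0r.
have delta1 (j : 'I_n) : \sum_i (i == j)%:R = 1 :> R.
  by rewrite -[RHS](delta (fun=> 1) j); apply: eq_bigr => i _; rewrite mulr1.
exists q; last first.
  apply/eqP; rewrite addrC -subr_eq -pmeanB; apply/eqP.
  under eq_bigr do rewrite qp -mulrA mulrBl.
  by rewrite -mulr_sumr sumrB !delta hi0; lra.
split; first split.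
- move=> i; rewrite mxE; have := p0 i; case: (eqVneq i i0) => [->|_];
    case: (_ == i1); rewrite /=; lra.
- under eq_bigr do rewrite mxE.
  by rewrite big_split /= p1 -mulr_sumr sumrB !delta1; lra.
under eq_bigr do rewrite qp.
apply: (@le_trans _ _ (\sum_i (e / 2 * ((i == i1)%:R + (i == i0)%:R)))).
  apply: ler_sum => i _; rewrite ler_norml.
  by case: (i == i1); case: (i == i0); rewrite /=; lra.
by rewrite -mulr_sumr big_split /= !delta1; lra.
Qed.

(** The map [r] to [(1 - e) p + e r] is a bijection from the dual set of CVaR at level [alpha] onto
    the set, and the mean is affine along it. *)
Lemma Q_c_max p alpha h e : prob_vec p -> 0 <= alpha < 1 -> 0 < e < 1 ->
  is_max [set pmean q h | q in Q_c p alpha e]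
    (pmean p h + e * (CVaR p alpha h - pmean p h)).
Proof.
move=> pp ha /andP[e0 e1].
have mix q r : (forall i, q 0 i = (1 - e) * p 0 i + e * r 0 i) ->
    pmean q h = pmean p h + e * (pmean r h - pmean p h).
  move=> qE; rewrite /pmean; under eq_bigr do rewrite qE mulrDl -!mulrA.
  rewrite big_split /= -!mulr_sumr; ring.
split.
  have [r [r1 rb <-]] := CVaR_dual_attained h pp ha.
  exists (\row_i ((1 - e) * p 0 i + e * r 0 i)); last by apply: mix => i; rewrite mxE.
  split.
    under eq_bigr do rewrite mxE.
    by rewrite big_split /= -!mulr_sumr r1 pp.2; lra.
  move=> i; rewrite mxE lerDl lerD2l -mulrA ler_pM2l // mulr_ge0 ?(ltW e0) //.
    by have /andP[] := rb i.
  by have /andP[] := rb i.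
move=> _ [q [q1 qb] <-].
pose r : 'rV[R]_n := \row_i (e^-1 * (q 0 i - (1 - e) * p 0 i)).
have er i : e * r 0 i = q 0 i - (1 - e) * p 0 i.
  by rewrite mxE mulrA mulfV ?gt_eqF // mul1r.
rewrite (mix q r) => [|i]; last by rewrite er; ring.
rewrite lerD2l ler_pM2l // lerD2r; apply: pmean_le_CVaR => //.
  under eq_bigr do rewrite mxE.
  rewrite -mulr_sumr sumrB -mulr_sumr q1 pp.2 mulr1 subKr mulVf ?gt_eqF //.
move=> i; have /andP[q0 qu] := qb i.
by rewrite -(ler_pM2l e0) mulr0 er -[X in _ && X](ler_pM2l e0) er; lra.
Qed.

End ExplicitWorstCases.

(** * Limits for the three sets whose worst case is linear in the radius *)

Section ExplicitSensitivities.
Context {R : realType} {n : nat}.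
Variables (p f : 'rV[R]_n) (beta : R).
Hypotheses (pp : prob_vec p) (p0 : forall i, 0 < p 0 i) (b1 : beta < 1).
Hypothesis pf : strict_quantile p beta f (VaR p beta f).

Lemma excess_eq0_exists : exists i, excess p beta f 0 i = 0.
Proof.
have [i fi] := strict_quantile_exists pf.
by exists i; rewrite mxE fi subrr maxxx.
Qed.

Lemma sensitivity_Q_b :
  sensitivity p beta f (Q_b p) (fun e => e) (CVaR p beta f - VaR p beta f).
Proof.
rewrite (CVaR_strict_quantile pp b1 pf) -/(excess p beta f) addrC addKr.
have [i0 hi0] := excess_eq0_exists.
apply: sensitivity_pmean_linear => // [d d0|]; near=> e; last first.
  have e0i : 0 < e <= p 0 i0.
    by apply/andP; split; near: e; [exact: nbhs_right_gt | exact: nbhs_right_le].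
  by apply: Q_b_max e0i => // i; exact: excess_ge0.
move=> q [q1 qb]; split; first by split => // i; have /andP[] := qb i.
have e0 : 0 < e by near: e; exact: nbhs_right_gt.
have ed : e <= d / 2 by near: e; apply: nbhs_right_le; rewrite divr_gt0.
apply: (@le_trans _ _ (2 * e)); last by rewrite mulrC -ler_pdivlMr.
by apply: sum_norm_relative_bound => // i; have /andP[] := qb i.
Unshelve. all: by end_near. Qed.

Lemma sensitivity_Q_TV i1 : (forall i, f 0 i <= f 0 i1) ->
  sensitivity p beta f (Q_TV p) (fun e => e)
    ((2 * (1 - beta))^-1 * (max_cost f - VaR p beta f)).
Proof.
move=> fmax; have [i0 hi0] := excess_eq0_exists.
have -> : max_cost f = f 0 i1.
  apply/eqP; rewrite eq_le; apply/andP; split.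
    by apply: ge_sup => [|_ [i _ <-] //]; exists (f 0 i1), i1.
  by apply: ub_le_sup; [exists (f 0 i1) => _ [i _ <-] | exists i1].
have vi1 : VaR p beta f <= f 0 i1.
  by have [i <-] := strict_quantile_exists pf.
have -> : (2 * (1 - beta))^-1 * (f 0 i1 - VaR p beta f) =
    (1 - beta)^-1 * (excess p beta f 0 i1 / 2).
  by rewrite mxE max_l ?subr_ge0 // invfM -mulrA mulrCA [X in _ * X]mulrC.
apply: sensitivity_pmean_linear => // [d d0|]; near=> e.
  move=> q [qq qe]; split => //; apply: (le_trans qe).
  by near: e; exact: nbhs_right_le.
have e0i : 0 < e <= p 0 i0.
  by apply/andP; split; near: e; [exact: nbhs_right_gt | exact: nbhs_right_le].
apply: Q_TV_max e0i => // i.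
by rewrite excess_ge0 !mxE le_max2 // lerD2r.
Unshelve. all: by end_near. Qed.

Lemma sensitivity_Q_c alpha : 0 <= alpha < 1 ->
  sensitivity p beta f (Q_c p alpha) (fun e => e)
    ((1 - beta)^-1 *
     (CVaR p alpha (excess p beta f) - pmean p (excess p beta f))).
Proof.
move=> ha; have a1 : 0 < 1 - alpha by rewrite subr_gt0; case/andP: ha.
apply: sensitivity_pmean_linear => // [d d0|]; near=> e; last first.
  apply: Q_c_max => //; apply/andP; split; near: e; first exact: nbhs_right_gt.
  exact: nbhs_right_lt.
have e0 : 0 < e by near: e; exact: nbhs_right_gt.
have e1 : e < 1 by near: e; exact: nbhs_right_lt.
(* The weights exceed [p] by a relative amount of at most [e / (1 - alpha)], which costs twice that
   in l1 distance. *)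
have ed : e <= d * (1 - alpha) / 2 by near: e; apply: nbhs_right_le; rewrite !divr_gt0 ?mulr_gt0.
have ea : 0 <= e / (1 - alpha) by rewrite divr_ge0 ?ltW.
move=> q [q1 qb]; split.
  split=> // i; have /andP[+ _] := qb i; apply: le_trans.
  by rewrite mulr_ge0 ?subr_ge0 ?ltW.
apply: (@le_trans _ _ (2 * (e / (1 - alpha)))).
  apply: sum_norm_relative_bound => // i; have /andP[_] := qb i.
  have := mulr_ge0 (ltW e0) (ltW (p0 i)); lra.
by rewrite mulrA ler_pdivrMr // mulrC -ler_pdivlMr.
Unshelve. all: by end_near. Qed.

End ExplicitSensitivities.

(** * The divergence function near 1 *)

Section PhiLocal.
Context {R : realType}.

(** A mean value theorem on both sides of [a]; the sign condition keeps [y] on the side of [x], so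
    that two applications can be chained. *)
Lemma MVT_at (g dg : R -> R) (a d : R) :
  (forall x, `|x - a| <= d -> is_derive x 1 g (dg x)) ->
  forall x, `|x - a| <= d -> exists y, [/\ `|y - a| <= d,
    0 <= (x - a) * (y - a) & g x - g a = dg y * (x - a)].
Proof.
move=> gd x; rewrite ler_norml => xd; have [ax|xa] := leP a x.
  have near_a y : y \in `[a, x] -> `|y - a| <= d.
    by rewrite in_itv /= ler_norml; lra.
  have [||y yax gE] := @MVT_segment R g dg a x ax.
  - by move=> y yax; apply/gd/near_a; exact: subset_itv_oo_cc.
  - by apply: derivable_within_continuous => y /near_a /gd [].
  - exists y; split => //; first exact: near_a.
    by move: yax; rewrite in_itv /=; nra.
have near_a y : y \in `[x, a] -> `|y - a| <= d.
  by rewrite in_itv /= ler_norml; lra.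
have [||y yax gE] := @MVT_segment R g dg x a (ltW xa).
- by move=> y yax; apply/gd/near_a; exact: subset_itv_oo_cc.
- by apply: derivable_within_continuous => y /near_a /gd [].
- exists y; split; first exact: near_a.
    by move: yax; rewrite in_itv /=; nra.
  by rewrite -opprB gE; ring.
Qed.

Variables (phi : R -> R).
Hypotheses (phi_conv : strictly_convex_pos phi) (phi_C2 : C2_pos phi).
Hypotheses (phi1 : phi 1 = 0) (dphi1 : derive1 phi 1 = 0).
Let c := derive1n 2 phi 1.
Hypothesis c0 : 0 < c.

(** Subtract the parabola of curvature [c - eta] or [c + eta]: the difference and its derivative
    vanish at 1, and its second derivative has constant sign nearby by continuity. *)
Lemma phi_quadratic (eta : R) : 0 < eta ->
  exists2 d : R, 0 < d <= 1 / 2 & forall z, `|z - 1| <= d ->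
    (c - eta) / 2 * (z - 1) ^+ 2 <= phi z <= (c + eta) / 2 * (z - 1) ^+ 2.
Proof.
move=> eta0; have [_ _ cont] := phi_C2 ltr01.
have /nbhs_ballP[r /= r0 rball] : \forall x \near (1 : R), `|c - derive1n 2 phi x| <= eta.
  by move/cvgrPdist_le : cont => /(_ _ eta0).
pose d := Num.min (r / 2) (1 / 2).
have d0 : 0 < d by rewrite lt_min !divr_gt0.
have d12 : d <= 1 / 2 by rewrite /d ge_min lexx orbT.
have dr : d < r.
  by apply: (@le_lt_trans _ _ (r / 2)); [rewrite /d ge_min lexx | lra].
have ddphi x : `|x - 1| <= d -> `|c - derive1n 2 phi x| <= eta.
  by move=> xd; apply: rball; rewrite /ball /= distrC; exact: le_lt_trans dr.
have pos x : `|x - 1| <= d -> 0 < x by rewrite ler_norml; lra.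
have D1 x : `|x - 1| <= d -> is_derive x 1 phi (derive1 phi x).
  by move=> /pos x0; have [D _ _] := phi_C2 x0; rewrite derive1E; exact: derivableP.
have D2 x : `|x - 1| <= d -> is_derive x 1 (derive1 phi) (derive1n 2 phi x).
  move=> /pos x0; have [_ D _] := phi_C2 x0.
  by rewrite derive1nS derive1E; exact: derivableP.
exists d => [|z zd]; first by rewrite d0.
pose G a x := phi x - a / 2 * (x - 1) ^+ 2.
have DG a x : `|x - 1| <= d -> is_derive x 1 (G a) (derive1 phi x - a * (x - 1)).
  move=> /D1 D; apply: (@is_deriveB _ _ _ phi) => //.
  apply: is_derive_eq; rewrite /GRing.scale /=; lra.
(* Two mean value steps, [z] to [x] to [y]; the weight [(z - 1) * (x - 1)] is nonnegative because
   [x] and [z] lie on the same side of 1. *)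
have GE a : exists2 y, `|y - 1| <= d &
    exists2 w, 0 <= w & G a z = (derive1n 2 phi y - a) * w.
  have [x [xd xz Gz]] := MVT_at (DG a) zd.
  have [y [yd yx dphi_x]] := MVT_at D2 xd.
  exists y => //; exists ((z - 1) * (x - 1)) => //.
  move: Gz dphi_x; rewrite dphi1 subr0 /G phi1 subrr expr0n /= mulr0 !subr0.
  by move=> -> ->; ring.
apply/andP; split.
  have [y /ddphi + [w w0]] := GE (c - eta); rewrite /G ler_norml => yc GE'.
  by rewrite -subr_ge0 GE' mulr_ge0 //; lra.
have [y /ddphi + [w w0]] := GE (c + eta); rewrite /G ler_norml => yc GE'.
by rewrite -subr_le0 GE' mulr_le0_ge0 //; lra.
Qed.

(** The quadratic bound holds at distance [d] from 1; convexity and [phi 1 = 0] carry it outwards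
    along the segment from 1 to [z]. Taking [eta = c / 2] yields the constant [c / 4]. *)
Lemma phi_coercive : exists d0 k : R, [/\ 0 < d0 <= 1 / 2, 0 < k &
  forall d z, 0 < d <= d0 -> 0 < z -> d <= `|z - 1| -> k * d ^+ 2 <= phi z].
Proof.
have [d0 hd0 quad] := phi_quadratic (divr_gt0 c0 (@ltr0n R 2)).
exists d0, (c / 4); split => //; first by rewrite divr_gt0.
move=> d z /andP[dpos dd0] z0 dz.
have w0 : 0 < `|z - 1| by apply: lt_le_trans dz.
pose t := d / `|z - 1|.
have t0 : 0 < t by rewrite divr_gt0.
have t1 : t <= 1 by rewrite ler_pdivrMr // mul1r.
have tz : `|t * z + (1 - t) * 1 - 1| = d.
  have -> : t * z + (1 - t) * 1 - 1 = t * (z - 1) by ring.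
  by rewrite normrM gtr0_norm // divfK // gt_eqF.
have low : c / 4 * d ^+ 2 <= phi (t * z + (1 - t) * 1).
  have /quad /andP[+ _] : `|t * z + (1 - t) * 1 - 1| <= d0 by rewrite tz.
  by rewrite -(real_normK (num_real (t * z + _ - 1))) tz; apply: le_trans; nra.
have [t1E|tn1] := eqVneq t 1.
  by move: low; rewrite t1E mul1r subrr mul0r addr0.
have t01 : 0 < t < 1 by rewrite t0 lt_neqAle tn1.
have z1 : z != 1 by rewrite -subr_eq0 -normr_gt0.
have := phi_conv z0 ltr01 z1 t01; rewrite phi1 mulr0 addr0 => up.
(* Positivity comes first: it is what allows [t * phi z] to be bounded by [phi z]. *)
have phiz : 0 < phi z.
  rewrite -(pmulr_rgt0 _ t0); apply: le_lt_trans up; apply: le_trans low.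
  by rewrite mulr_ge0 ?sqr_ge0 // divr_ge0 // ltW.
apply: (le_trans low); apply: (le_trans (ltW up)).
by rewrite ler_piMl // ltW.
Qed.

Lemma phi_ge0 z : 0 < z -> 0 <= phi z.
Proof.
move=> z0; have [->|z1] := eqVneq z 1; first by rewrite phi1.
have [d0 [k [/andP[d0p _] k0 low]]] := phi_coercive.
have w0 : 0 < `|z - 1| by rewrite normr_gt0 subr_eq0.
apply: le_trans (low (Num.min d0 `|z - 1|) z _ z0 _).
- by rewrite mulr_ge0 ?sqr_ge0 // ltW.
- by rewrite lt_min d0p w0 ge_min lexx.
- by rewrite ge_min lexx orbT.
Qed.

Lemma phi_nonincreasing x y : 0 < x -> x <= y -> y < 1 -> phi y <= phi x.
Proof.
move=> x0; rewrite le_eqVlt => /predU1P[->//|xy] y1.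
have x1 : 0 < 1 - x by lra.
pose t := (1 - y) / (1 - x).
have t01 : 0 < t < 1 by rewrite divr_gt0 ?ltr_pdivrMr //= ; lra.
have yE : y = t * x + (1 - t) * 1.
  have : t * (1 - x) = 1 - y by rewrite divfK // gt_eqF.
  by lra.
have := phi_conv x0 ltr01 (_ : x != 1) t01; rewrite -yE phi1 mulr0 addr0.
rewrite lt_eqF; last lra.
move=> /(_ isT)/ltW /le_trans; apply; rewrite ler_piMl ?phi_ge0 //; lra.
Qed.

(** Monotonicity to the left of 1 gives a limit in the extended reals, so the [lim] in [phi_ext] is
    a true limit. *)
Lemma phi_ext0_cvg : cvg ((phi x)%:E @[x --> 0^'+]).
Proof.
apply: nonincreasing_at_right_is_cvge; near=> b => x y.
rewrite !in_itv /= => /andP[x0 xb] /andP[y0 yb] xy.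
rewrite lee_fin; apply: phi_nonincreasing => //.
by apply: (lt_trans yb); near: b; exact: nbhs_right_lt.
Unshelve. all: by end_near. Qed.

Lemma phi_ext_coercive : exists d0 k : R, [/\ 0 < d0 <= 1 / 2, 0 < k &
  forall d z, 0 < d <= d0 -> 0 <= z -> d <= `|z - 1| ->
    ((k * d ^+ 2)%:E <= phi_ext phi z)%E].
Proof.
have [d0 [k [hd0 k0 low]]] := phi_coercive.
exists d0, k; split => // d z hd z0 dz; rewrite /phi_ext.
case: ifPn => [zpos|_]; first by rewrite lee_fin; exact: low.
apply: lime_ge; first exact: phi_ext0_cvg.
near=> x; rewrite lee_fin; apply: low => //.
(* Such [x] stay at distance at least 1/2 from 1, hence at least [d], and the bound passes to the
   limit at 0. *)
have : x <= 1 / 2 by near: x; exact: nbhs_right_le.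
by move=> x12; rewrite ler0_norm; lra.
Unshelve. all: by end_near. Qed.

Lemma phi_ext_ge0 z : 0 <= z -> (0 <= phi_ext phi z)%E.
Proof.
move=> z0; rewrite /phi_ext; case: ifPn => [zpos|_]; first by rewrite lee_fin phi_ge0.
apply: lime_ge; first exact: phi_ext0_cvg.
by near=> x; rewrite lee_fin phi_ge0.
Unshelve. all: by end_near. Qed.

End PhiLocal.

(** * Divergence balls *)

Lemma continuous_wsum (R : realType) (T : topologicalType) n (w : 'I_n -> R)
    (F : 'I_n -> T -> R) : (forall i, continuous (F i)) ->
  continuous (fun x => \sum_i w i * F i x).
Proof.
move=> Fc x; apply: cvg_big => [|i _]; first exact: add_continuous.
by apply: cvgM; [exact: cvg_cst | exact: Fc].
Qed.

Lemma continuous_max_scale (R : realType) (T : topologicalType) (a b : R)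
    (F : T -> R) : continuous F -> continuous (fun x => Num.max (F x * a) b).
Proof.
move=> Fc x; apply: (@continuous_max R T (fun x => F x * a) (fun=> b)).
  by apply: cvgM; [exact: Fc | exact: cvg_cst].
exact: cvg_cst.
Qed.

Section PhiDivergence.
Context {R : realType} {n : nat}.
Implicit Types (p q r h : 'rV[R]_n) (e x : R).

Lemma weighted_cauchy_schwarz p (a b : 'I_n -> R) : (forall i, 0 <= p 0 i) ->
  (\sum_i p 0 i * (a i * b i)) ^+ 2 <=
  (\sum_i p 0 i * a i ^+ 2) * (\sum_i p 0 i * b i ^+ 2).
Proof.
move=> p0; set X := \sum_i p 0 i * (a i * b i).
set A := \sum_i p 0 i * a i ^+ 2; set V := \sum_i p 0 i * b i ^+ 2.
have pb i : 0 <= p 0 i * b i ^+ 2 by rewrite mulr_ge0 // sqr_ge0.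
have V0 : 0 <= V by apply: sumr_ge0.
have [VE|Vn0] := eqVneq V 0.
  have X0 : X = 0.
    apply: big1 => i _; have : p 0 i * b i ^+ 2 = 0 by apply: (psumr_eq0P _ VE).
    by move/eqP; rewrite mulf_eq0 sqrf_eq0 => /orP[] /eqP ->; rewrite ?mul0r ?mulr0.
  by rewrite X0 VE expr0n /= mulr0.
have Vp : 0 < V by rewrite lt_def Vn0.
rewrite -subr_ge0 -(pmulr_rge0 _ Vp).
have sqE v x : \sum_i p 0 i * (v * a i - x * b i) ^+ 2 =
    v ^+ 2 * A - 2 * v * x * X + x ^+ 2 * V.
  rewrite /A /X /V !mulr_sumr -sumrB -big_split /=.
  by apply: eq_bigr => i _; ring.
(* The defect, scaled by [V], is the weighted square norm of [V a - X b]. *)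
have -> : V * (A * V - X ^+ 2) = \sum_i p 0 i * (V * a i - X * b i) ^+ 2.
  by rewrite sqE; ring.
by apply: sumr_ge0 => i _; rewrite mulr_ge0 // sqr_ge0.
Qed.

Variables (p : 'rV[R]_n) (phi : R -> R).
Hypotheses (pp : prob_vec p) (p0 : forall i, 0 < p 0 i).
Hypotheses (phi_conv : strictly_convex_pos phi) (phi_C2 : C2_pos phi).
Hypotheses (phi1 : phi 1 = 0) (dphi1 : derive1 phi 1 = 0).
Let c := derive1n 2 phi 1.
Hypothesis c0 : 0 < c.

(** All terms of the divergence are nonnegative, so one ratio farther than [d] from 1 already costs
    at least [m * (k * d1 ^+ 2)], with [m] a lower bound on the weights; a smaller [e] rules this
    out. *)
Lemma Q_phi_near_p (d : R) : 0 < d -> \forall e \near 0^'+, forall q,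
  Q_phi p phi e q -> forall i, `|q 0 i / p 0 i - 1| <= d.
Proof.
move=> dpos.
have [d0 [k [/andP[d0p _] k0 low]]] := phi_ext_coercive phi_conv phi_C2 phi1 dphi1 c0.
have [m m0 pm] := prob_vec_gt0_lb p0.
pose d1 := Num.min d d0.
have d1p : 0 < d1 by rewrite lt_min dpos.
near=> e => q [[q0 q1] qe] i; rewrite leNgt; apply/negP => dz.
have z0 j : 0 <= q 0 j / p 0 j by rewrite divr_ge0 // ltW.
have term_ge0 j : (0 <= (p 0 j)%R%:E * phi_ext phi (q 0 j / p 0 j)%R)%E.
  by apply: mule_ge0; [rewrite lee_fin ltW | exact: phi_ext_ge0].
have : ((m * (k * d1 ^+ 2))%:E <= e%:E)%E.
  apply: le_trans qe; rewrite (bigD1 i) //=.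
  apply: le_trans (leeDl _ _); last by apply: sume_ge0.
  have kd0 : 0 <= k * d1 ^+ 2 by rewrite mulr_ge0 ?sqr_ge0 // ltW.
  rewrite EFinM; apply: lee_pmul; rewrite ?lee_fin // ?(ltW m0) //.
  apply: low => //; first by rewrite d1p ge_min lexx orbT.
  by rewrite (le_trans _ (ltW dz)) // ge_min lexx.
apply/negP; rewrite -ltNge lte_fin; near: e; apply: nbhs_right_lt.
by rewrite !mulr_gt0 // exprn_gt0.
Unshelve. all: by end_near. Qed.

Lemma sum_phi_ext e q : (forall i, 0 < q 0 i / p 0 i) ->
  (\sum_i (p 0 i)%R%:E * phi_ext phi (q 0 i / p 0 i)%R <= e%:E)%E =
  (\sum_i p 0 i * phi (q 0 i / p 0 i) <= e).
Proof.
move=> z0; rewrite -lee_fin -sumEFin; congr (_ <= _)%E.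
by apply: eq_bigr => i _; rewrite /phi_ext z0.
Qed.

Lemma near1_gt0 (d z : R) : d <= 1 / 2 -> `|z - 1| <= d -> 0 < z.
Proof. by move=> d2; rewrite ler_norml; lra. Qed.

Lemma Q_phi_of_near e q (d : R) : d <= 1 / 2 -> \sum_i q 0 i = 1 ->
  (forall i, `|q 0 i / p 0 i - 1| <= d) ->
  \sum_i p 0 i * phi (q 0 i / p 0 i) <= e -> Q_phi p phi e q.
Proof.
move=> d2 q1 qd qe.
have z0 i : 0 < q 0 i / p 0 i by exact: near1_gt0 (qd i).
split; last by rewrite sum_phi_ext.
split => // i; have := z0 i; rewrite pmulr_lgt0 ?invr_gt0 //; exact: ltW.
Qed.

Lemma Q_phi_dist (d : R) : 0 < d -> \forall e \near 0^'+, forall q,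
  Q_phi p phi e q -> prob_vec q /\ \sum_i `|q 0 i - p 0 i| <= d.
Proof.
move=> d0; near=> e => q Qq; split; first by case: Qq.
have qd : forall i, `|q 0 i / p 0 i - 1| <= d.
  by move: q Qq; near: e; exact: Q_phi_near_p.
rewrite -[leRHS]mulr1 -pp.2 mulr_sumr; apply: ler_sum => i _.
have -> : q 0 i - p 0 i = (q 0 i / p 0 i - 1) * p 0 i.
  by rewrite mulrBl mul1r divfK // gt_eqF.
by rewrite normrM (gtr0_norm (p0 i)) ler_wpM2r // ltW.
Unshelve. all: by end_near. Qed.

Lemma p_in_Q_phi e : 0 < e -> Q_phi p phi e p.
Proof.
move=> e0; have pK i : p 0 i / p 0 i = 1 by rewrite divff // gt_eqF.
apply: (@Q_phi_of_near _ _ (1 / 2)) => // [|i|].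
- exact: pp.2.
- by rewrite pK subrr normr0; lra.
- by rewrite big1 ?ltW // => i _; rewrite pK phi1 mulr0.
Qed.

(* For small e the set lies in a box on which every ratio is at least 1/2, so
   replacing phi by z |-> phi (max z (1/2)) makes its constraint continuous. *)
Lemma Q_phi_has_max h : \forall e \near 0^'+,
  exists2 q, Q_phi p phi e q & forall r, Q_phi p phi e r -> pmean r h <= pmean q h.
Proof.
pose zmax z : R := Num.max z (1 / 2).
pose F q := \sum_i p 0 i * phi (zmax (q 0 i / p 0 i)).
near=> e; have e0 : 0 < e by near: e; exact: nbhs_right_gt.
have half : 0 < (1 / 2 : R) by rewrite divr_gt0.
have nearQ : forall q, Q_phi p phi e q -> forall i, `|q 0 i / p 0 i - 1| <= 1 / 2.
  by near: e; exact: Q_phi_near_p.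
have zmaxE z : `|z - 1| <= 1 / 2 -> zmax z = z.
  by move=> hz; rewrite /zmax max_l //; move: hz; rewrite ler_norml; lra.
have coord i : continuous (fun q : 'rV[R]_n => q 0 i) by exact: coord_continuous.
have Fcont : continuous F.
  apply: continuous_wsum => i q.
  have zpos : 0 < zmax (q 0 i / p 0 i) by rewrite lt_max half orbT.
  apply: (@continuous_comp _ _ _ (fun q : 'rV[R]_n => zmax (q 0 i / p 0 i)) phi).
    exact: (continuous_max_scale (coord i)).
  have [D _ _] := phi_C2 zpos.
  by apply: differentiable_continuous; apply/derivable1_diffP.
have mean_cont g : continuous (fun q => pmean q g).
  have -> : (fun q => pmean q g) = (fun q => \sum_i g 0 i * q 0 i).
    by apply/funext => q; apply: eq_bigr => i _; rewrite mulrC.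
  exact: continuous_wsum.
have sum_cont : continuous (fun q : 'rV[R]_n => \sum_i q 0 i).
  have -> : (fun q : 'rV[R]_n => \sum_i q 0 i) = pmean^~ (const_mx 1).
    by apply/funext => q; apply: eq_bigr => i _; rewrite mxE mulr1.
  exact: mean_cont.
(* The condition that all ratios lie in [1/2, 3/2], written coordinatewise to be a compact product
   of segments. *)
pose box := [set q : 'rV[R]_n |
  forall i, `[p 0 i / 2, 3 / 2 * p 0 i]%classic (q 0 i)].
have boxP q : box q <-> forall i, `|q 0 i / p 0 i - 1| <= 1 / 2.
  split => H i; have := H i; have := p0 i; rewrite /= in_itv /=;
    set z := q 0 i / p 0 i; (have -> : q 0 i = z * p 0 i by rewrite divfK // gt_eqF);
    rewrite ler_norml; clearbody z; move=> pz /andP[l u]; apply/andP; split; nra.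
have QE : Q_phi p phi e =
    box `&` [set q | \sum_i q 0 i = 1] `&` [set q | F q <= e].
  apply/seteqP; split => q.
    move=> Qq; have qn := nearQ q Qq; have [[q0 q1] qe] := Qq.
    split; first by split => //; apply/boxP.
    move: qe; rewrite /= sum_phi_ext => [|i]; last by apply: near1_gt0 (qn i).
    by apply: le_trans; apply: ler_sum => i _; rewrite zmaxE.
  move=> [[/boxP qn q1] Fq]; apply: (@Q_phi_of_near _ _ (1 / 2)) => //.
  by apply: le_trans Fq; apply: ler_sum => i _; rewrite zmaxE.
have cQ : compact (Q_phi p phi e).
  rewrite QE; apply: compact_closedI; last first.
    by move/continuous_closedP : Fcont => /(_ _ (@closed_le _ e)).
  apply: compact_closedI.
    apply: (@rV_compact R n (fun i => `[p 0 i / 2, 3 / 2 * p 0 i]%classic)) => i.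
    exact: segment_compact.
  by move/continuous_closedP : sum_cont => /(_ _ (@closed_eq _ 1)).
have [|q qQ qmax] := EVT_max_rV _ cQ (continuous_subspaceT (mean_cont h)).
  by exists p; exact: p_in_Q_phi.
exists q; first by rewrite inE in qQ.
by move=> r Qr; apply: qmax; rewrite inE.
Unshelve. all: by end_near. Qed.

(** Centring [h] is free as [q - p] sums to 0; Cauchy-Schwarz then produces the variance of [h]. *)
Lemma pmean_centered q h : prob_vec q ->
  pmean q h - pmean p h =
  \sum_i p 0 i * ((q 0 i / p 0 i - 1) * (h 0 i - pmean p h)).
Proof.
move=> [_ q1]; rewrite -pmeanB.
transitivity (\sum_i (q 0 i - p 0 i) * (h 0 i - pmean p h)).
  under [RHS]eq_bigr do rewrite mulrBr.
  by rewrite sumrB -mulr_suml sumrB q1 pp.2 subrr mul0r subr0.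
apply: eq_bigr => i _; rewrite [RHS]mulrA; congr (_ * _).
by rewrite mulrBr mulr1 mulrCA divff ?mulr1 // gt_eqF.
Qed.

Lemma pvariance_ge0 h : 0 <= pvariance p h.
Proof. by apply: sumr_ge0 => i _; rewrite mulr_ge0 ?sqr_ge0 // ltW. Qed.

(** With [x] below [c], [phi] dominates the parabola of curvature [x], so the weighted squares of
    [q / p - 1] sum to at most [2 * e / x]. *)
Lemma Q_phi_pmean_le h x : 0 < x < c -> \forall e \near 0^'+,
  forall q, Q_phi p phi e q ->
    pmean q h - pmean p h <= Num.sqrt (2 / x * pvariance p h) * Num.sqrt e.
Proof.
move=> /andP[x0 xc].
have cx : 0 < c - x by rewrite subr_gt0.
have [d /andP[d0 d12] quad] := phi_quadratic phi_C2 phi1 dphi1 cx.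
near=> e; have e0 : 0 < e by near: e; exact: nbhs_right_gt.
have nearQ : forall q, Q_phi p phi e q -> forall i, `|q 0 i / p 0 i - 1| <= d.
  by near: e; exact: Q_phi_near_p.
move=> q Qq; have qn := nearQ q Qq; have [qq qe] := Qq.
rewrite pmean_centered //.
set X := \sum_i _.
have V0 := pvariance_ge0 h.
have Xle : X ^+ 2 <= 2 / x * pvariance p h * e.
  have cs := weighted_cauchy_schwarz (fun i => q 0 i / p 0 i - 1)
    (fun i => h 0 i - pmean p h) (fun i => ltW (p0 i)).
  apply: (le_trans cs); rewrite -/(pvariance p h) mulrAC ler_wpM2r //.
  rewrite mulrAC ler_pdivlMr // mulrC -ler_pdivrMl //.
  move: qe; rewrite sum_phi_ext => [|i]; last exact: near1_gt0 (qn i).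
  apply: le_trans; rewrite mulrA mulr_sumr; apply: ler_sum => i _.
  rewrite mulrCA ler_pM2l //; have /andP[+ _] := quad _ (qn i).
  by rewrite opprB addrCA subrr addr0 [2^-1 * x]mulrC.
have Lge0 : 0 <= 2 / x * pvariance p h by rewrite mulr_ge0 // divr_ge0 // ltW.
rewrite -sqrtrM //.
by apply: le_trans (ler_norm X) _; rewrite -sqrtr_sqr ler_wsqrtr.
Unshelve. all: by end_near. Qed.

(** With [x] above [c], the tilt by [t] costs at most [x / 2 * t ^+ 2 * V] and gains [t * V]; [t] is
    set to spend exactly [e]. *)
Lemma Q_phi_pmean_ge h x : c < x -> \forall e \near 0^'+,
  exists2 q, Q_phi p phi e q &
    Num.sqrt (2 / x * pvariance p h) * Num.sqrt e <= pmean q h - pmean p h.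
Proof.
move=> cx; have x0 : 0 < x by exact: lt_trans cx.
have xc : 0 < x - c by rewrite subr_gt0.
have [d /andP[d0 d12] quad] := phi_quadratic phi_C2 phi1 dphi1 xc.
(* With zero variance no tilt can be normalised, but the required gain is 0 and [p] itself provides
   it. *)
have [VE|Vn0] := eqVneq (pvariance p h) 0.
  near=> e; exists p; first exact: p_in_Q_phi.
  by rewrite VE mulr0 sqrtr0 mul0r subrr.
have Vp : 0 < pvariance p h by rewrite lt_def Vn0 pvariance_ge0.
set V := pvariance p h in Vp *; set mu := pmean p h.
pose K := Num.sqrt (2 / (x * V)).
have K0 : 0 < K by rewrite sqrtr_gt0 divr_gt0 ?mulr_gt0.
(* A positive uniform bound on the centred excess; [small] makes [t * B <= d], so all ratios stay
   where the parabola bound holds. *)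
pose B := 1 + \sum_i `|h 0 i - mu|.
have B0 : 0 < B by rewrite ltr_wpDr // sumr_ge0.
have r0 : 0 < d / (K * B) by rewrite divr_gt0 ?mulr_gt0.
have hB i : `|h 0 i - mu| <= B.
  by rewrite /B (bigD1 i) //= addrCA lerDl addr_ge0 // sumr_ge0.
near=> e; have e0 : 0 < e by near: e; exact: nbhs_right_gt.
have small : Num.sqrt e <= d / (K * B).
  rewrite -[leRHS](gtr0_norm r0) -sqrtr_sqr ler_wsqrtr //.
  by near: e; apply: nbhs_right_le; rewrite exprn_gt0.
pose t := K * Num.sqrt e.
have t0 : 0 <= t by rewrite mulr_ge0 ?sqrtr_ge0.
have t2 : t ^+ 2 * (x * V) = 2 * e.
  rewrite exprMn !sqr_sqrtr ?(ltW e0) ?divr_ge0 ?mulr_ge0 ?(ltW x0) ?(ltW Vp) //.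
  by rewrite mulrAC divfK // mulf_neq0 // gt_eqF.
pose q : 'rV[R]_n := \row_i (p 0 i * (1 + t * (h 0 i - mu))).
have qz i : q 0 i / p 0 i - 1 = t * (h 0 i - mu).
  by rewrite mxE mulrC mulKf ?gt_eqF // addrC addKr.
have qn i : `|q 0 i / p 0 i - 1| <= d.
  rewrite qz normrM ger0_norm //; apply: (@le_trans _ _ (t * B)).
    by rewrite ler_wpM2l.
  by rewrite /t mulrAC mulrC -ler_pdivlMr // mulr_gt0.
have q1 : \sum_i q 0 i = 1.
  under eq_bigr do rewrite mxE mulrDr mulr1 mulrCA mulrBr.
  rewrite big_split /= -mulr_sumr sumrB -mulr_suml pp.2 mul1r.
  by rewrite subrr mulr0 addr0.
have Qq : Q_phi p phi e q.
  apply: (Q_phi_of_near d12) => //.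
  apply: (@le_trans _ _ (\sum_i x / 2 * t ^+ 2 * (p 0 i * (h 0 i - mu) ^+ 2))).
    apply: ler_sum => i _; rewrite [leRHS]mulrCA ler_pM2l //.
    have /andP[_] := quad _ (qn i); rewrite addrC subrK [X in X ^+ 2]qz exprMn.
    by rewrite mulrA.
  by rewrite -mulr_sumr -/(pvariance p h) -/V; move: t2; lra.
exists q => //; rewrite pmean_centered //; last by case: Qq.
under [leRHS]eq_bigr do rewrite qz -mulrA -expr2 mulrCA.
rewrite -mulr_sumr -/(pvariance p h) -/V /t [leRHS]mulrAC ler_wpM2r ?sqrtr_ge0 //.
have -> : 2 / x * V = 2 / (x * V) * V ^+ 2.
  by rewrite invfM expr2 !mulrA divfK // gt_eqF.
by rewrite sqrtrM ?divr_ge0 ?mulr_ge0 ?(ltW x0) ?(ltW Vp) // sqrtr_sqr gtr0_norm.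
Unshelve. all: by end_near. Qed.

(** The quotient is squeezed between the constants for curvatures [c + y] and [c - y], and the
    constant depends continuously on the curvature at [c]. *)
Lemma sensitivity_Q_phi f beta : beta < 1 ->
  strict_quantile p beta f (VaR p beta f) ->
  sensitivity p beta f (Q_phi p phi) (fun e => Num.sqrt e)
    ((1 - beta)^-1 *
     Num.sqrt (2 / c * pvariance p (excess p beta f))).
Proof.
move=> b1 pf; set h := excess p beta f.
pose m e := sup [set pmean q h | q in Q_phi p phi e].
have mP : \forall e \near 0^'+,
    is_max [set pmean q h | q in Q_phi p phi e] (m e).
  near=> e; have [q Qq qmax] : exists2 q, Q_phi p phi e q &
      forall r, Q_phi p phi e r -> pmean r h <= pmean q h.
    by near: e; exact: Q_phi_has_max.
  have ub : ubound [set pmean q h | q in Q_phi p phi e] (pmean q h).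
    by move=> _ [r Qr <-]; exact: qmax.
  suff -> : m e = pmean q h by split => //; exists q.
  apply/eqP; rewrite eq_le; apply/andP; split.
    by apply: ge_sup => //; exists (pmean q h), q.
  by apply: ub_le_sup; [exists (pmean q h) | exists q].
apply: (sensitivity_pmean pp b1 pf _ mP); first by move=> d; exact: Q_phi_dist.
pose L x := Num.sqrt (2 / x * pvariance p h).
have Lcont : {for c, continuous L}.
  apply: continuous_comp; last exact: sqrt_continuous.
  apply: cvgM; last exact: cvg_cst.
  by apply: cvgM; [exact: cvg_cst | apply: cvgV => //; rewrite gt_eqF].
apply/cvgrPdist_le => eps eps0.
have /nbhs_ballP[r /= r0 rball] : \forall x \near c, `|L c - L x| <= eps.
  by move/cvgrPdist_le : Lcont => /(_ _ eps0).
(* Small enough for continuity of [L] and for [c - y] to remain positive. *)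
pose y := Num.min (r / 2) (c / 2).
have y0 : 0 < y by rewrite lt_min !divr_gt0.
have yr : y < r by apply: (@le_lt_trans _ _ (r / 2)); [rewrite ge_min lexx | lra].
have yc : y < c.
  by apply: (@le_lt_trans _ _ (c / 2)); [rewrite ge_min lexx orbT | move: c0; lra].
have Lm : `|L c - L (c - y)| <= eps.
  by apply: rball; rewrite /ball /= opprB addrCA subrr addr0 gtr0_norm.
have Lp : `|L c - L (c + y)| <= eps.
  by apply: rball; rewrite /ball /= opprD addrA subrr add0r normrN gtr0_norm.
near=> e; have e0 : 0 < e by near: e; exact: nbhs_right_gt.
have s0 : 0 < Num.sqrt e by rewrite sqrtr_gt0.
have [[q Qq qm] ub] : is_max [set pmean q h | q in Q_phi p phi e] (m e).
  by near: e.
have upper : (m e - pmean p h) / Num.sqrt e <= L (c - y).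
  rewrite ler_pdivrMr // -qm; move: q Qq {qm}; near: e.
  by apply: Q_phi_pmean_le; rewrite subr_gt0 yc /= gtrBl.
have lower : L (c + y) <= (m e - pmean p h) / Num.sqrt e.
  rewrite ler_pdivlMr //.
  have [r' Qr' hr'] : exists2 q, Q_phi p phi e q &
      L (c + y) * Num.sqrt e <= pmean q h - pmean p h.
    by near: e; apply: Q_phi_pmean_ge; rewrite ltrDl.
  by apply: (le_trans hr'); rewrite lerD2r; apply: ub; exists r'.
move: Lm Lp upper lower; rewrite -/(L c) !ler_norml; lra.
Unshelve. all: by end_near. Qed.

End PhiDivergence.

Theorem proposition4p9 (R : realType) (n : nat) (f p : 'rV[R]_n) (beta : R)
    (hp : prob_vec p) (hp0 : forall i, 0 < p 0 i) (hbeta : 0 <= beta < 1)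
    (s : 'S_n) (hs : sorts_decreasing s f)
    (k : 'I_n)
    (hk : \sum_(i < n | (i < k)%N) p 0 (s i) < 1 - beta
          < \sum_(i < n | (i < k.+1)%N) p 0 (s i)) :
  [/\ forall phi : R -> R,
        strictly_convex_pos phi -> C2_pos phi ->
        phi 1 = 0 -> derive1 phi 1 = 0 -> 0 < derive1n 2 phi 1 ->
        sensitivity p beta f (Q_phi p phi) (fun e => Num.sqrt e)
          ((1 - beta)^-1 *
           Num.sqrt (2 / derive1n 2 phi 1 * pvariance p (excess p beta f))),
      sensitivity p beta f (Q_TV p) (fun e => e)
        ((2 * (1 - beta))^-1 * (max_cost f - VaR p beta f)),
      sensitivity p beta f (Q_b p) (fun e => e)
        (CVaR p beta f - VaR p beta f) &
      forall alpha : R, 0 <= alpha < 1 ->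
        sensitivity p beta f (Q_c p alpha) (fun e => e)
          ((1 - beta)^-1 *
           (CVaR p alpha (excess p beta f) - pmean p (excess p beta f)))].
Proof.
have /andP[_ b1] := hbeta; have [p_ge0 _] := hp.
have quant := sorted_strict_quantile p_ge0 hs hk.
have vE := VaR_strict_quantile hp quant; rewrite -vE in quant.
have n_gt0 : (0 < n)%N by exact: leq_ltn_trans (ltn_ord k).
(* Position 0 of the decreasing order carries the maximal cost. *)
have fmax i : f 0 i <= f 0 (s (Ordinal n_gt0)).
  by rewrite -(permKV s i); exact: hs.
split=> [phi hconv hC2 phi1 dphi1 c0||| alpha ha].
- exact: sensitivity_Q_phi.
- exact: sensitivity_Q_TV fmax.
- exact: sensitivity_Q_b.
- exact: sensitivity_Q_c.
Qed.
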